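(* Let $k>r\ge 2$ and $m\ge 1$ be integers and let $n\ge k+\binom{k-2}{r-1}$. If $T(n,K_k^{(r)})=T(n,K_k^{(r)};m)$, then $$m\le \left\lfloor\frac{k-1}{r-1}\right\rfloor.$$
   Context: An $r$-graph ($r$-uniform hypergraph) is a pair $H=(V,E)$ with $V$ a finite vertex set and $E$ a set of $r$-element subsets of $V$. Connected components of a hypergraph are taken in the usual sense (isolated vertices count as components). Say an $r$-graph on vertex set $V$ satisfies the covering condition for $k$ if every $k$-element subset of $V$ contains at least one edge. $T(n,K_k^{(r)})$ denotes the smallest integer $t$ such that there exists an $r$-graph with $n$ vertices and $t$ edges satisfying the covering condition for $k$. For an integer $m\ge1$, $T(n,K_k^{(r)};m)$ denotes the smallest integer $t$ such that there exists an $r$-graph with $n$ vertices, $t$ edges and exactly $m$ connected components satisfying the covering condition for $k$. *)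

(* Defs.v *)
From mathcomp Require Import all_boot.

Set Implicit Arguments.
Unset Strict Implicit.
Unset Printing Implicit Defensive.

(* A hypergraph on the vertex set V is identified with its edge set. *)
Definition hypergraph (V : finType) := {set {set V}}.

Definition uniform (V : finType) (r : nat) (H : hypergraph V) : bool :=
  [forall E in H, #|E| == r].

Definition covering (V : finType) (k : nat) (H : hypergraph V) : bool :=
  [forall S : {set V}, (#|S| == k) ==> [exists E in H, E \subset S]].

Definition adjacent (V : finType) (H : hypergraph V) : rel V :=
  [rel x y | [exists E in H, (x \in E) && (y \in E)]].

(* [connect] is reflexive, so every isolated vertex is counted. *)
Definition num_components (V : finType) (H : hypergraph V) : nat :=
  n_comp (adjacent H) predT.

(* n_comp is meaningful because the relation is symmetric. *)
Lemma adjacent_connect_sym (V : finType) (H : hypergraph V) :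
  connect_sym (adjacent H).
Proof.
apply: sym_connect_sym => x y /=.
by apply: eq_existsb => E; rewrite [(x \in E) && _]andbC.
Qed.

(* The least number of edges of a hypergraph satisfying P, or None if there is
   no such hypergraph. *)
Definition min_edges (V : finType) (P : pred (hypergraph V)) : option nat :=
  omap (fun H : hypergraph V => #|H|)
    [pick H : hypergraph V |
       P H && [forall H' : hypergraph V, P H' ==> (#|H| <= #|H'|)]].

Lemma min_edgesP (V : finType) (P : pred (hypergraph V)) (t : nat) :
  min_edges P = Some t <->
  (exists2 H, P H & #|H| = t) /\ (forall H, P H -> t <= #|H|).
Proof.
rewrite /min_edges; case: pickP => [H /andP[PH /forallP minH] | noH] /=.
  split=> [[<-] | [[H' PH' <-] minH']].
    by split=> [|H' PH']; [exists H | apply: (implyP (minH H'))].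
  by congr Some; apply/eqP; rewrite eqn_leq minH' // (implyP (minH H')).
split=> // -[[H PH <-] minH]; have /negP[] := negbT (noH H).
by rewrite PH; apply/forallP=> H'; apply/implyP/minH.
Qed.

Definition turan (n k r : nat) : option nat :=
  min_edges (fun H : hypergraph 'I_n => uniform r H && covering k H).

Definition turan_comp (n k r m : nat) : option nat :=
  min_edges (fun H : hypergraph 'I_n =>
    [&& uniform r H, covering k H & num_components H == m]).

(* T(n, K_k^(r)) is always defined when r <= k, so that
   turan n k r = turan_comp n k r m never holds as None = None. *)
Lemma turan_defined (n k r : nat) : r <= k -> turan n k r != None.
Proof.
move=> le_rk; pose P (H : hypergraph 'I_n) := uniform r H && covering k H.
have PK : P [set E : {set 'I_n} | #|E| == r].
  apply/andP; split; first by apply/forall_inP=> E; rewrite inE.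
  apply/forall_inP=> S /eqP cardS.
  have: 0 < #|[set E : {set 'I_n} | E \subset S & #|E| == r]|.
    by rewrite cards_draws cardS bin_gt0.
  case/card_gt0P=> E; rewrite inE => /andP[sES cardE].
  by apply/exists_inP; exists E; rewrite ?inE.
case: (arg_minnP (fun H : hypergraph 'I_n => #|H|) PK) => H PH minH.
have -> : turan n k r = Some #|H|; last by [].
by apply/min_edgesP; split; first by exists H.
Qed.

(* Main.v *)
Require Import Defs.
From mathcomp Require Import all_boot.

Set Implicit Arguments.
Unset Strict Implicit.
Unset Printing Implicit Defensive.

(** An extremal hypergraph has no isolated vertex [v]: a maximal independent
    set containing [v] has fewer than [k] elements, so by pigeonhole two edges
    [y |: B] and [y' |: B] share the part [B] inside it, and replacing both by
    the single edge [v |: B] preserves the covering condition.  Hence every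
    component contains an edge; [r - 1] vertices of one edge from each component
    form an independent set of size [m * (r - 1)], which is less than [k]. *)

Definition independent (V : finType) (H : hypergraph V) (S : {set V}) : bool :=
  [forall E in H, ~~ (E \subset S)].

Lemma covering_subset (V : finType) (k : nat) (H : hypergraph V) (S : {set V}) :
  covering k H -> k <= #|S| -> exists2 E, E \in H & E \subset S.
Proof.
move=> covH le_kS.
have: 0 < #|[set A : {set V} | A \subset S & #|A| == k]|.
  by rewrite cards_draws bin_gt0.
case/card_gt0P=> A; rewrite inE => /andP[sAS cardA].
have /exists_inP[E EH sEA] := implyP (forallP covH A) cardA.
by exists E; rewrite // (subset_trans sEA).
Qed.

Lemma card_independent (V : finType) (k : nat) (H : hypergraph V)
    (S : {set V}) :
  covering k H -> independent H S -> #|S| < k.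
Proof.
move=> covH /forall_inP indS; rewrite ltnNge; apply/negP.
by case/(covering_subset covH)=> E /indS/negP.
Qed.

(** Each [y] outside a maximal independent [J] containing [v] completes some part [B] of [J :\ v] to
    an edge. There are more such [y] than candidates for [B], so two of them share one. *)
Lemma twin_edges (V : finType) (k r : nat) (H : hypergraph V) (v : V) :
  2 <= r -> k + 'C(k - 2, r - 1) <= #|V| ->
  uniform r H -> covering k H -> (forall E, E \in H -> v \notin E) ->
  exists B : {set V}, exists y, exists y',
    [/\ y != y', y \notin B, y' \notin B, y |: B \in H & y' |: B \in H].
Proof.
move=> r_ge2 leV uniH covH isov.
have ind1 : independent H [set v].
  apply/forall_inP=> E EH; apply/negP=> /subset_leq_card.
  by rewrite cards1 (eqP (forall_inP uniH E EH)) leqNgt r_ge2.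
have [J /maxsetP[indJ maxJ] /[!sub1set] vJ] := maxset_exists (P := independent H) ind1.
have ltJk := card_independent covH indJ.
pose good y (B : {set V}) :=
  [&& B \subset J :\ v, #|B| == r - 1 & y |: B \in H].
(* The default [set0] only makes [f] total: by [goodf] it is never reached outside [J]. *)
pose f y := odflt set0 [pick B | good y B].
have goodf y : y \notin J -> good y (f y).
  move=> yJ; rewrite /f; case: pickP => //= noB.
  (* Otherwise [y |: J] would be a larger independent set, against the maximality of [J]. *)
  suff indyJ : independent H (y |: J).
    by move: yJ; rewrite -(maxJ _ indyJ (subsetUr _ _)) setU11.
  apply/forall_inP=> E EH; apply/negP=> sE.
  have yE : y \in E.
    apply: contraT => yE; have /negP[] := forall_inP indJ E EH.
    apply/subsetP=> z zE; have := subsetP sE z zE.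
    by rewrite !inE; case: eqP => // eq_zy; rewrite -eq_zy zE in yE.
  have /negP[] := negbT (noB (E :\ y)).
  rewrite /good setD1K // EH andbT; apply/andP; split; last first.
    have := cardsD1 y E; rewrite yE (eqP (forall_inP uniH E EH)) => ->.
    by rewrite addKn.
  apply/subsetP=> z /[!inE] /andP[zy zE].
  have:= subsetP sE z zE; rewrite !inE (negPf zy) /= => ->; rewrite andbT.
  by apply: contraTneq zE => ->; apply: isov.
(* Since [#|J| < k], more than ['C(k - 2, r - 1)] vertices lie outside [J], while [J :\ v] has at
   most [k - 2] elements to form [B] from. *)
have : ~~ dinjectiveb f (mem (~: J)).
  apply/negP=> /dinjectiveP /card_in_imset cardf.
  have sf : f @: (~: J) \subset
      [set B : {set V} | B \subset J :\ v & #|B| == r - 1].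
    apply/subsetP=> _ /imsetP[y yJ ->]; rewrite inE.
    by rewrite inE in yJ; have /and3P[-> ->] := goodf y yJ.
  have := subset_leq_card sf; rewrite cards_draws cardf.
  have := cardsD1 v J; have := cardsC J; rewrite vJ => eqV eqJ.
  have lt_Jv : 2 + #|J :\ v| <= k by rewrite eqJ in ltJk.
  have leJ2 : #|J :\ v| <= k - 2.
    by rewrite leq_subRL // (leq_trans (leq_addr _ _) lt_Jv).
  move/leq_trans/(_ (leq_bin2l (r - 1) leJ2)); rewrite leqNgt => /negP[].
  by rewrite -(ltn_add2l #|J|) eqV (leq_trans _ leV) // ltn_add2r.
case/dinjectivePn=> y yJ [y' /andP[/= ne_y yJ']] eqf.
rewrite !inE in yJ yJ'.
have /and3P[sB _ Hy] := goodf y yJ; have /and3P[_ _ Hy'] := goodf y' yJ'.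
have out z : z \notin J -> z \notin f y.
  by apply: contraNN => /(subsetP sB) /setD1P[].
by exists (f y), y, y'; rewrite eq_sym out ?out // {2}eqf.
Qed.

(** A [k]-set not containing [B] keeps its old edge; one containing [B] and [v] contains the new
    edge; one containing [B] but not [v] is handled by an exchange. *)
Lemma isolated_not_minimum (V : finType) (k r : nat) (H : hypergraph V)
    (v : V) :
  2 <= r -> k + 'C(k - 2, r - 1) <= #|V| ->
  uniform r H -> covering k H -> (forall E, E \in H -> v \notin E) ->
  exists2 H' : hypergraph V, uniform r H' && covering k H' & #|H'| < #|H|.
Proof.
move=> r_ge2 leV uniH covH isov.
have [B [y [y' [ne_y yB yB' Hy Hy']]]] :=
  twin_edges r_ge2 leV uniH covH isov.
have cardB : #|B|.+1 = r.
  by rewrite -(eqP (forall_inP uniH _ Hy)) cardsU1 yB.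
have vB : v \notin B.
  by apply: contraNN (isov _ Hy) => vB; rewrite !inE vB orbT.
have [b bB] : exists b, b \in B.
  by apply/card_gt0P; rewrite -ltnS cardB.
have neE : y' |: B != y |: B.
  apply: contraNneq yB' => eqE; have := setU11 y' B.
  by rewrite eqE !inE eq_sym (negPf ne_y).
(* Two distinct edges are removed and at most one is added. *)
exists (v |: B |: H :\ (y |: B) :\ (y' |: B)); last first.
  rewrite cardsU1 (cardsD1 (y |: B) H) Hy.
  rewrite [X in _ < _ + X](cardsD1 (y' |: B)) in_setD1 neE Hy' /=.
  by rewrite add1n ltnS leq_add2r leq_b1.
apply/andP; split.
  apply/forall_inP=> E /setU1P[-> | /setD1P[_ /setD1P[_ /(forall_inP uniH)]]] //.
  by rewrite cardsU1 vB add1n cardB.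
apply/forallP=> S; apply/implyP=> /eqP cardS; apply/exists_inP.
(* Both removed edges contain [B], so any edge that does not contain [B] survives. *)
have keep E : E \in H -> ~~ (B \subset E) ->
    E \in v |: B |: H :\ (y |: B) :\ (y' |: B).
  move=> EH BE; rewrite !inE EH andbT; apply/orP; right.
  by apply/andP; split; apply: contraNneq BE => ->; apply: subsetUr.
have [sBS | nBS] := boolP (B \subset S); last first.
  have [E EH sES] := covering_subset (S := S) covH (eq_leq (esym cardS)).
  by exists E => //; apply: keep => //; apply: contraNN nBS => /subset_trans->.
have [vS | vS] := boolP (v \in S).
  by exists (v |: B); rewrite ?setU11 // subUset sub1set vS.
(* Since no edge contains [v], exchanging [b] for [v] in [S] yields an edge that avoids [b]. *)
have [|E EH sE] := covering_subset (S := v |: S :\ b) covH.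
  rewrite cardsU1 !inE (negPf vS) andbF add1n -cardS.
  by rewrite (cardsD1 b S) (subsetP sBS).
have sEb : E \subset S :\ b.
  apply/subsetP=> z zE; have /setU1P[eq_zv | //] := subsetP sE z zE.
  by move: (isov E EH); rewrite -eq_zv zE.
exists E; last by rewrite (subset_trans sEb) ?subsetDl.
apply: keep => //; apply/negP=> /subsetP/(_ b bB) /(subsetP sEb).
by rewrite setD11.
Qed.

Lemma num_components_bound (V : finType) (k r : nat) (H : hypergraph V) :
  0 < r -> uniform r H -> covering k H ->
  (forall v, exists2 E, E \in H & v \in E) ->
  num_components H * (r - 1) < k.
Proof.
move=> r_gt0 uniH covH noiso.
pose e := adjacent H; pose rt := root e.
have symE := adjacent_connect_sym H.
have rt_edge E z w : E \in H -> z \in E -> w \in E -> rt z = rt w.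
  move=> EH zE wE; apply/(rootP symE)/connect1/exists_inP.
  by exists E; rewrite ?zE.
pose g x := odflt set0 [pick E in H | x \in E].
have gP x : g x \in H /\ x \in g x.
  rewrite /g; case: pickP => [E /andP[] // | noE].
  by have [E EH xE] := noiso x; have := noE E; rewrite /= EH xE.
(* In each component, [U] consists of the edge chosen at its root, minus that root: [r - 1]
   vertices, one too few for an edge. *)
pose U := [set z | z \in g (rt z) :\ rt z].
have cardg x : #|g x :\ x| = r - 1.
  have [gH xg] := gP x; have := cardsD1 x (g x).
  by rewrite xg (eqP (forall_inP uniH _ gH)) => ->; rewrite addKn.
have cardU : #|U| = num_components H * (r - 1).
  (* [U] is counted component by component, each represented by its root. *)
  rewrite -sum1_card (partition_big rt (roots e)) /=; last first.
    by move=> z _; apply: roots_root.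
  rewrite (eq_bigr (fun=> r - 1)) => [|x /eqP rtx].
    rewrite sum_nat_const /num_components /n_comp_mem; congr (_ * _).
    by apply: eq_card => x; rewrite !inE andbT.
  rewrite sum1dep_card -(cardg x) cardsE; apply: eq_card => z.
  rewrite unfold_in /= inE; apply/andP/idP => [[zU /eqP <-] // | zg].
  have [gH xg] := gP x; have /setD1P[_ zgx] := zg.
  have rtz : rt z = x by rewrite (rt_edge (g x) z x).
  by rewrite rtz.
rewrite -cardU; apply: (card_independent covH).
apply/forall_inP=> E EH; apply/negP=> sEU.
have cardE := eqP (forall_inP uniH E EH).
have [z zE] : exists z, z \in E by apply/card_gt0P; rewrite cardE.
(* All vertices of an edge have the same root, so an edge inside [U] would lie in the part of [U] in
   a single component. *)
have : E \subset g (rt z) :\ rt z.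
  apply/subsetP=> w wE; have := subsetP sEU w wE.
  by rewrite inE (rt_edge E w z).
move/subset_leq_card; rewrite cardg cardE leqNgt => /negP[].
by rewrite subn1 prednK.
Qed.

Theorem theorem1p1 (n k r m : nat)
  (hr : 2 <= r) (hk : r < k) (hm : 1 <= m)
  (hn : k + 'C(k - 2, r - 1) <= n)
  (hT : turan n k r = turan_comp n k r m) :
  m <= (k - 1) %/ (r - 1).
Proof.
have := turan_defined n (ltnW hk).
case eqT: (turan n k r) => [t|] // _; rewrite eqT in hT.
have [_ minT] := (min_edgesP _ _).1 eqT.
have [[H /and3P[uniH covH /eqP compH] cardH] _] := (min_edgesP _ _).1 (esym hT).
have r1_gt0 : 0 < r - 1 by rewrite subn_gt0.
have k_gt0 : 0 < k by apply: leq_ltn_trans hk.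
rewrite leq_divRL // -ltnS [X in _ < X](_ : _ = k); last by rewrite subn1 prednK.
rewrite -compH; apply: num_components_bound => //; first exact: ltnW.
(* An isolated vertex would yield a covering hypergraph with fewer than [t] edges; its number of
   components is irrelevant, since [t] is also the unrestricted minimum. *)
move=> v; apply/exists_inP; apply: contraT.
rewrite negb_exists_in => /forall_inP isov.
have [|H' PH'] := isolated_not_minimum hr _ uniH covH isov.
  by rewrite card_ord.
by rewrite cardH ltnNge minT.
Qed.
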